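(* For $i=O(n^{a})$ and $p=O(n^{b})$ with $0\leq a\leq b<1$, the Bayes factor for intrinsic priors $B_{pi}(\mathbf{y})$ is consistent if $\lim_{n\to\infty}\delta_{pi}>0$. That is, when sampling from $M_{i}$, $B_{pi}(\mathbf{y})\to 0$ in probability as $n\to\infty$, and when sampling from an alternative model $M_{p}$ with $\lim_{n\to\infty}\delta_{pi}>0$, $B_{pi}(\mathbf{y})\to\infty$ in probability as $n\to\infty$.
   Context: For each sample size $n$ let $1\le i=i_n<p=p_n<n$ be integers, let $\mathbf{X}_{p}$ be an $n\times p$ design matrix of full column rank, and let $\mathbf{X}_{i}$ be an $n\times i$ submatrix of $\mathbf{X}_{p}$ formed by $i$ of its columns. The reduced sampling model $M_{i}$ is $\mathbf{y}\sim N(\mathbf{X}_{i}\boldsymbol{\alpha}_{i},\sigma_{i}^{2}\mathbf{I}_{n})$ and the full sampling model $M_{p}$ is $\mathbf{y}\sim N(\mathbf{X}_{p}\boldsymbol{\beta}_{p},\sigma_{p}^{2}\mathbf{I}_{n})$, where $\boldsymbol{\alpha}_i\in\mathbb{R}^i$, $\boldsymbol{\beta}_p\in\mathbb{R}^p$, $\sigma_i,\sigma_p>0$. ''Sampling from $M$'' means that for each $n$ the data $\mathbf{y}\in\mathbb{R}^n$ are drawn from $M$ with a fixed (nonrandom) sequence of parameters. Define $\mathbf{H}_{j}=\mathbf{X}_{j}(\mathbf{X}_{j}^{\prime}\mathbf{X}_{j})^{-1}\mathbf{X}_{j}^{\prime}$ for $j\in\{i,p\}$, $$\mathcal{B}_{ip}=\frac{\mathbf{y}^{\prime}(\mathbf{I}_{n}-\mathbf{H}_{p})\mathbf{y}}{\mathbf{y}^{\prime}(\mathbf{I}_{n}-\mathbf{H}_{i})\mathbf{y}},\qquad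 \delta_{pi}=\frac{1}{\sigma_{p}^{2}}\boldsymbol{\beta}_{p}^{\prime}\frac{\mathbf{X}_{p}^{\prime}(\mathbf{I}_{n}-\mathbf{H}_{i})\mathbf{X}_{p}}{n}\boldsymbol{\beta}_{p},$$ where $\delta_{pi}$ (the ''distance'' from $M_p$ to $M_i$) is computed at the parameters of $M_p$ from which the data are drawn; it is assumed that $\lim_{n\to\infty}\delta_{pi}$ exists and is finite. The Bayes factor for intrinsic priors for comparing $M_{p}$ against $M_{i}$ is $$B_{pi}(\mathbf{y})=\frac{2}{\pi}(p+1)^{(p-i)/2}\int_{0}^{\pi/2}\frac{\sin^{p-i}\varphi\,(n+(p+1)\sin^{2}\varphi)^{(n-p)/2}}{(n\mathcal{B}_{ip}+(p+1)\sin^{2}\varphi)^{(n-i)/2}}\,d\varphi.$$ *)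

(* Defs.v *)
From HB Require Import structures.
From mathcomp Require Export all_boot all_order all_algebra.
From mathcomp Require Export all_classical all_reals all_analysis.
Export Order.TTheory GRing.Theory Num.Theory.
Export numFieldNormedType.Exports.

Set Implicit Arguments.
Unset Strict Implicit.
Unset Printing Implicit Defensive.

Local Open Scope classical_set_scope.
Local Open Scope ring_scope.

(* The law on R^n is N(mu, Sigma): every linear functional t'y has the
   univariate law N(t'mu, t'Sigma t). The second parameter of [normal_prob] is
   the standard deviation, and the library gives it a junk value at 0, so that
   N(m, 0) has to be spelled out as the Dirac mass at m. *)
Definition univ_normal (R : realType) (m v : R) (A : set R) : \bar R :=
  if v == 0 then \d_m A else normal_prob m (Num.sqrt v) A.

Definition normal_vector (R : realType) (d : measure_display)
    (T : measurableType d) (P : probability T R) (n : nat)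
    (y : T -> 'cV[R]_n) (mu : 'cV[R]_n) (Sigma : 'M[R]_n) : Prop :=
  (forall k : 'I_n, measurable_fun [set: T] (fun w => y w k 0)) /\
  (forall (t : 'cV[R]_n) (A : set R), measurable A ->
     P [set w | A ((t^T *m y w) 0 0)] =
     univ_normal ((t^T *m mu) 0 0) ((t^T *m Sigma *m t) 0 0) A).

(* Convergence in probability of extended-real statistics; the n-th one lives
   on its own probability space, as the data for each sample size do. *)
Definition cvg_prob0 (R : realType) (d : nat -> measure_display)
    (T : forall n, measurableType (d n)) (P : forall n, probability (T n) R)
    (Z : forall n, T n -> \bar R) : Prop :=
  forall eps : R, 0 < eps ->
    P n [set w | (eps%:E < `|Z n w|)%E] @[n --> \oo] --> 0%E.

Definition cvg_prob_pinfty (R : realType) (d : nat -> measure_display)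
    (T : forall n, measurableType (d n)) (P : forall n, probability (T n) R)
    (Z : forall n, T n -> \bar R) : Prop :=
  forall M : R, P n [set w | (M%:E < Z n w)%E] @[n --> \oo] --> 1%E.

Definition hat_mx (R : realType) (n k : nat) (X : 'M[R]_(n, k)) : 'M[R]_n :=
  X *m invmx (X^T *m X) *m X^T.

Definition rss (R : realType) (n k : nat) (X : 'M[R]_(n, k)) (y : 'cV[R]_n) : R :=
  (y^T *m (1%:M - hat_mx X) *m y) 0 0.

Definition rss_ratio (R : realType) (n i p : nat) (Xi : 'M[R]_(n, i))
    (Xp : 'M[R]_(n, p)) (y : 'cV[R]_n) : R :=
  rss Xp y / rss Xi y.

Definition model_distance (R : realType) (n i p : nat) (Xi : 'M[R]_(n, i))
    (Xp : 'M[R]_(n, p)) (beta : 'cV[R]_p) (sigma : R) : R :=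
  (sigma ^+ 2)^-1 *
  (beta^T *m (n%:R^-1 *: (Xp^T *m (1%:M - hat_mx Xi) *m Xp)) *m beta) 0 0.

(* Extended-real valued: on the null event rss Xp y = 0 the integral may
   diverge. *)
Definition bayes_factor (R : realType) (n i p : nat) (Xi : 'M[R]_(n, i))
    (Xp : 'M[R]_(n, p)) (y : 'cV[R]_n) : \bar R :=
  ((2 / pi * p.+1%:R `^ ((p%:R - i%:R) / 2))%:E *
   \int[lebesgue_measure]_(phi in `[0%R, (pi / 2)%R])
     (sin phi ^+ (p - i) *
      (n%:R + p.+1%:R * sin phi ^+ 2) `^ ((n%:R - p%:R) / 2) /
      (n%:R * rss_ratio Xi Xp y + p.+1%:R * sin phi ^+ 2)
        `^ ((n%:R - i%:R) / 2))%:E)%E.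

(* Main.v *)
From HB Require Import structures.
Require Import Defs.
From mathcomp Require Import measurable_realfun lra ring.

Set Implicit Arguments.
Unset Strict Implicit.
Unset Printing Implicit Defensive.

Local Open Scope classical_set_scope.
Local Open Scope ring_scope.

(* Put [k = p - i], [b = rss_ratio] and [D = rss Xi y - rss Xp y], so that
   [b^-1 - 1 = D / rss Xp y]. Writing [v = (p + 1) sin^2 phi], the integrand is
   [sin^k phi * ((n + v) / (n b + v))^((n - p)/2) * (n b + v)^(-k/2)].

   Under M_i, [rss Xp y] is of order [(n - p) sigma^2] and [D] is at most of
   order [k sigma^2]. Then [(n + v) / (n b + v) <= b^-1 <= exp (D / rss Xp y)]
   bounds the Bayes factor by [(C (p + 1) / n)^(k/2)], which vanishes as
   [p = o(n)].

   Under M_p, [D] is of order at least [n sigma^2 delta_pi], so [b <= 1 - eta]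
   for some [eta > 0], and the exponential gain [exp (eta (n - p) / 8)] beats
   the loss [(4 n)^(-k/2)] since [p log n = o(n)].

   The chi-square estimates use neither independence nor fourth moments: a
   quadratic form [y' A y] of an orthogonal projection [A] is the sum of the
   squares of the coordinates of [A y], which are centred normal variables with
   total variance [sigma^2 tr A]. Markov's inequality bounds it from above, and
   the small-ball estimate of each coordinate, averaged with the variances as
   weights, bounds it from below. *)

(** * Orthogonal projections and least squares *)

Section Euclid.
Variable R : realType.

Lemma trmx_mul_self n (u : 'cV[R]_n) : (u^T *m u) 0 0 = \sum_j (u j 0) ^+ 2.
Proof. by rewrite !mxE; apply: eq_bigr => j _; rewrite !mxE expr2. Qed.

Lemma trmx_mul_self_ge0 n (u : 'cV[R]_n) : 0 <= (u^T *m u) 0 0.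
Proof. by rewrite trmx_mul_self; apply: sumr_ge0 => j _; exact: sqr_ge0. Qed.

Lemma trmx_mul_self_eq0 n (u : 'cV[R]_n) : (u^T *m u) 0 0 = 0 -> u = 0.
Proof.
rewrite trmx_mul_self => /psumr_eq0P h; apply/matrixP => j k.
rewrite ord1 mxE; apply/eqP; rewrite -sqrf_eq0; apply/eqP/h => // l _.
exact: sqr_ge0.
Qed.

(** If a row vector [v] satisfies [v X' X = 0], then [v X'] has squared norm [v X' X v' = 0], and
    full column rank of [X] forces [v = 0]. *)
Lemma gram_unitmx n k (X : 'M[R]_(n, k)) :
  \rank X = k -> X^T *m X \in unitmx.
Proof.
move=> rX; rewrite -row_free_unit -kermx_eq0; apply/eqP/row_matrixP => j.
rewrite row0; set v := row j _.
have hv : v *m (X^T *m X) = 0 by rewrite /v -row_mul mulmx_ker row0.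
have fX : row_free X^T by rewrite /row_free mxrank_tr rX.
apply/(row_free_inj fX); rewrite mul0mx -[v *m _]trmxK.
rewrite (@trmx_mul_self_eq0 _ (v *m X^T)^T) ?trmx0//.
by rewrite trmxK trmx_mul trmxK -mulmxA (mulmxA X^T) mulmxA hv mul0mx mxE.
Qed.

Section Hat.
Variables (n k : nat) (X : 'M[R]_(n, k)).
Hypothesis rX : \rank X = k.

Lemma trmx_hat : (hat_mx X)^T = hat_mx X.
Proof.
by rewrite /hat_mx !trmx_mul trmxK trmx_inv trmx_mul trmxK mulmxA.
Qed.

Lemma hat_mulmx : hat_mx X *m X = X.
Proof. by rewrite /hat_mx -!mulmxA mulVmx ?mulmx1 // gram_unitmx. Qed.

Lemma hat_idem : hat_mx X *m hat_mx X = hat_mx X.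
Proof. by rewrite {2}/hat_mx !mulmxA hat_mulmx. Qed.

Lemma mxtrace_hat : \tr (hat_mx X) = k%:R.
Proof. by rewrite /hat_mx mxtrace_mulC mulmxA mulmxV ?mxtrace1 // gram_unitmx. Qed.

End Hat.

Definition orthoproj n (A : 'M[R]_n) := A^T = A /\ A *m A = A.

Lemma orthoproj_hat n k (X : 'M[R]_(n, k)) :
  \rank X = k -> orthoproj (hat_mx X).
Proof. by move=> rX; split; [exact: trmx_hat | exact: hat_idem]. Qed.

(** Transposing [A B = B] gives [B A = B], so the square of [A - B] is [A - B - B + B]. *)
Lemma orthoproj_subr n (A B : 'M[R]_n) :
  orthoproj A -> orthoproj B -> A *m B = B -> orthoproj (A - B).
Proof.
move=> [tA iA] [tB iB] AB; split; first by rewrite linearB /= tA tB.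
have BA : B *m A = B by rewrite -[LHS]trmxK trmx_mul tA tB AB tB.
by rewrite mulmxBl !mulmxBr iA iB AB BA subrr subr0.
Qed.

Lemma orthoproj1 n : orthoproj (1%:M : 'M[R]_n).
Proof. by split; rewrite ?trmx1 ?mulmx1. Qed.

Lemma quad_orthoproj n (A : 'M[R]_n) (y : 'cV[R]_n) : orthoproj A ->
  (y^T *m A *m y) 0 0 = \sum_j ((A *m y) j 0) ^+ 2.
Proof.
by move=> [tA iA]; rewrite -trmx_mul_self trmx_mul tA -!mulmxA (mulmxA A) iA.
Qed.

Lemma quad_orthoproj_ge0 n (A : 'M[R]_n) (y : 'cV[R]_n) : orthoproj A ->
  0 <= (y^T *m A *m y) 0 0.
Proof. by move=> /quad_orthoproj->; apply: sumr_ge0 => j _; exact: sqr_ge0. Qed.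

(** Expand [|A y - g|^2 >= 0]. Under the full model this reduces a lower bound on a noncentral
    quadratic form to one on a single linear form, whose law is univariate normal. *)
Lemma quad_orthoproj_ge n (A : 'M[R]_n) (y g : 'cV[R]_n) : orthoproj A ->
  A *m g = g ->
  2 * (g^T *m y) 0 0 - (g^T *m g) 0 0 <= (y^T *m A *m y) 0 0.
Proof.
move=> pA Ag; have [tA iA] := pA.
have := trmx_mul_self_ge0 (A *m y - g).
have gA : g^T *m A = g^T by rewrite -[g in RHS]Ag trmx_mul tA.
have e : (A *m y - g)^T *m (A *m y - g) =
    y^T *m A *m y - y^T *m g - (g^T *m y - g^T *m g).
  have -> : (A *m y - g)^T = y^T *m A - g^T by rewrite linearB /= trmx_mul tA.
  rewrite mulmxBl !mulmxBr -!mulmxA (mulmxA A) iA Ag.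
  by rewrite (mulmxA g^T) gA.
rewrite e !mxE.
have -> : \sum_j y^T 0 j * g j 0 = \sum_j g^T 0 j * y j 0.
  by apply: eq_bigr => j _; rewrite !mxE mulrC.
by lra.
Qed.

(** Selecting columns is multiplication by [colsub c 1%:M]. As [X] has full column rank, the rank is
    that of this selection matrix, which its transpose inverts on the left when [c] is injective. *)
Lemma rank_colsub n i p (X : 'M[R]_(n, p)) (c : 'I_i -> 'I_p) :
  \rank X = p -> injective c -> \rank (colsub c X) = i.
Proof.
move=> rX ic; rewrite -mxrank_tr.
have -> : colsub c X = X *m colsub c 1%:M by rewrite mulmx_colsub mulmx1.
rewrite trmx_mul mxrankMfree; last by rewrite /row_free mxrank_tr rX.
apply/eqP; rewrite -[_ == _]/(row_free _); apply/row_freeP.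
exists (colsub c 1%:M); apply/matrixP => j k; rewrite !mxE.
rewrite (bigD1 (c j)) //= big1 ?addr0 => [|l lj]; rewrite !mxE.
  by rewrite eqxx mul1r (inj_eq ic).
by rewrite (negbTE lj) mul0r.
Qed.

Section Nested.
Variables (n i p : nat) (X : 'M[R]_(n, p)) (c : 'I_i -> 'I_p).
Hypotheses (rX : \rank X = p) (ic : injective c).
Let Xi := colsub c X.
Let rXi : \rank Xi = i := rank_colsub rX ic.

Lemma hat_mulmx_colsub : hat_mx X *m Xi = Xi.
Proof. by rewrite /Xi mulmx_colsub hat_mulmx. Qed.

Lemma hat_mul_hat_colsub : hat_mx X *m hat_mx Xi = hat_mx Xi.
Proof. by rewrite {2}/hat_mx !mulmxA hat_mulmx_colsub. Qed.

Lemma orthoproj_residual : orthoproj (1%:M - hat_mx X).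
Proof.
apply: orthoproj_subr; [exact: orthoproj1|exact: orthoproj_hat|].
by rewrite mul1mx.
Qed.

Lemma orthoproj_hatB : orthoproj (hat_mx X - hat_mx Xi).
Proof.
by apply: orthoproj_subr; [exact: orthoproj_hat..|exact: hat_mul_hat_colsub].
Qed.

Lemma mxtrace_residual : \tr (1%:M - hat_mx X) = n%:R - p%:R.
Proof. by rewrite linearB /= mxtrace1 mxtrace_hat. Qed.

Lemma mxtrace_hatB : \tr (hat_mx X - hat_mx Xi) = p%:R - i%:R.
Proof. by rewrite linearB /= !mxtrace_hat. Qed.

Lemma residual_mulmx : (1%:M - hat_mx X) *m X = 0.
Proof. by rewrite mulmxBl mul1mx hat_mulmx // subrr. Qed.

Lemma residual_mulmx_colsub : (1%:M - hat_mx X) *m Xi = 0.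
Proof. by rewrite mulmxBl mul1mx hat_mulmx_colsub subrr. Qed.

Lemma hatB_mulmx_colsub : (hat_mx X - hat_mx Xi) *m Xi = 0.
Proof. by rewrite mulmxBl hat_mulmx_colsub hat_mulmx // subrr. Qed.

Lemma hatB_mulmx : (hat_mx X - hat_mx Xi) *m X = (1%:M - hat_mx Xi) *m X.
Proof. by rewrite !mulmxBl mul1mx hat_mulmx. Qed.

Lemma rss_colsub y :
  rss Xi y = rss X y + (y^T *m (hat_mx X - hat_mx Xi) *m y) 0 0.
Proof.
rewrite /rss.
have -> : 1%:M - hat_mx Xi = 1%:M - hat_mx X + (hat_mx X - hat_mx Xi).
  by rewrite addrA subrK.
by rewrite mulmxDr mulmxDl mxE.
Qed.

(** As [hat_mx X] fixes [X], the residual operator of the reduced model acts on the mean as the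
    projection [hat_mx X - hat_mx Xi]. The distance is thus the normalised squared norm of [g], the
    part of the mean that the reduced model misses. *)
Lemma model_distanceE (beta : 'cV[R]_p) (sigma : R) :
  let g := (hat_mx X - hat_mx Xi) *m (X *m beta) in
  model_distance Xi X beta sigma =
  (sigma ^+ 2)^-1 * (n%:R^-1 * (g^T *m g) 0 0).
Proof.
rewrite /model_distance -scalemxAr -scalemxAl mxE; congr (_ * (_ * _)).
have [tD iD] := orthoproj_hatB.
rewrite mulmxA -(mulmxA _ _ X) -hatB_mulmx !trmx_mul tD -!mulmxA.
by rewrite (mulmxA (hat_mx X - _) (hat_mx X - _)) iD.
Qed.

End Nested.
End Euclid.

(** * Normal laws *)

Section Normal.
Variable R : realType.
Local Notation mu := (@lebesgue_measure R).

(** The Radon-Nikodym derivative of the normal law and [normal_pdf] have the same integral over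
    every measurable set, so they agree almost everywhere. *)
Lemma ge0_integral_normal_prob (m s : R) (f : _ -> \bar R) :
  measurable_fun setT f -> (forall x, 0 <= f x)%E ->
  (\int[normal_prob m s]_x f x = \int[mu]_x (f x * (normal_pdf m s x)%:E))%E.
Proof.
move=> mf f0; have dom := @normal_prob_dominates R m s.
rewrite -(Radon_Nikodym_SigmaFinite.change_of_variables dom)//.
have mpdf : measurable_fun setT (fun x => (normal_pdf m s x)%:E).
  by apply/measurable_EFinP; exact: measurable_normal_pdf.
have mRN : measurable_fun setT (Radon_Nikodym_SigmaFinite.f (normal_prob m s) mu).
  exact: measurable_int (Radon_Nikodym_SigmaFinite.f_integrable _).
apply: ae_eq_integral => //; [exact: emeasurable_funM..|].
apply: ae_eqe_mul2l; apply: integral_ae_eq => //.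
  exact: Radon_Nikodym_SigmaFinite.f_integrable.
by move=> E _ mE; rewrite -Radon_Nikodym_SigmaFinite.f_integral.
Qed.

Lemma normal_peakM2 (s : R) : normal_peak (2 * s) = normal_peak s / 2.
Proof.
rewrite /normal_peak.
have -> : ((2 * s) ^+ 2 * pi *+ 2 = 2 ^+ 2 * (s ^+ 2 * pi *+ 2) :> R) by ring.
by rewrite sqrtrM ?sqr_ge0 // sqrtr_sqr ger0_norm // invfM mulrC.
Qed.

(* Domination by the density of twice the standard deviation bounds the second
   moment without an integration by parts. *)
Lemma sqr_normal_pdf_le (m s x : R) : s != 0 ->
  (x - m) ^+ 2 * normal_pdf m s x <= 6 * s ^+ 2 * normal_pdf m (2 * s) x.
Proof.
move=> s0; rewrite !normal_pdfE ?mulf_neq0 // normal_peakM2 /normal_fun.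
set q := (x - m) ^+ 2; set P := normal_peak s.
have P0 : 0 <= P by exact: normal_peak_ge0.
have s2 : 0 < s ^+ 2 by rewrite exprn_even_gt0.
set t := q / s ^+ 2.
(* The exponent [- t / 2] is split: [- t / 8] belongs to the wider density, and the remaining
   [- 3 t / 8] absorbs the factor [t]. *)
have -> : - q / (s ^+ 2 *+ 2) = - (t / 8) - 3 / 8 * t.
  by rewrite /t; field; rewrite s0.
have -> : - q / ((2 * s) ^+ 2 *+ 2) = - (t / 8).
  by rewrite /t; field; rewrite s0.
have -> : q = t * s ^+ 2 by rewrite /t divfK // gt_eqF.
rewrite expRD (expRN (3 / 8 * t)); set E := expR (- (t / 8)).
have E0 : 0 <= E by exact: expR_ge0.
have h : t / expR (3 / 8 * t) <= 3.
  rewrite ler_pdivrMr ?expR_gt0 //.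
  have := expR_ge1Dx (3 / 8 * t); have := expR_gt0 (3 / 8 * t); lra.
have -> : t * s ^+ 2 * (P * (E / expR (3 / 8 * t))) =
  (s ^+ 2 * P * E) * (t / expR (3 / 8 * t)) by ring.
have -> : 6 * s ^+ 2 * (P / 2 * E) = (s ^+ 2 * P * E) * 3 by field.
by apply: ler_wpM2l => //; apply: mulr_ge0 => //; apply: mulr_ge0 => //; exact: ltW.
Qed.

Lemma normal_second_moment_le (m s : R) : s != 0 ->
  (\int[normal_prob m s]_x ((x - m) ^+ 2)%:E <= (6 * s ^+ 2)%:E)%E.
Proof.
move=> s0.
have msq : measurable_fun setT (fun x : R => (x - m) ^+ 2).
  by apply: measurable_funX; exact: measurable_funB.
rewrite ge0_integral_normal_prob; last 2 first.
- exact/measurable_EFinP.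
- by move=> x; rewrite lee_fin sqr_ge0.
apply: (@le_trans _ _
    (\int[mu]_x ((6 * s ^+ 2)%:E * (normal_pdf m (2 * s) x)%:E))%E).
  apply: ge0_le_integral => //=.
  - by move=> x _; rewrite -EFinM lee_fin mulr_ge0 ?sqr_ge0 ?normal_pdf_ge0.
  - by apply/measurable_EFinP/measurable_funM => //; exact: measurable_normal_pdf.
  - by apply/measurable_EFinP/measurable_funM => //; exact: measurable_normal_pdf.
  - by move=> x _; rewrite -!EFinM lee_fin sqr_normal_pdf_le.
rewrite ge0_integralZl //=.
- by rewrite integral_normal_pdf mule1.
- by apply/measurable_EFinP; exact: measurable_normal_pdf.
- by move=> x _; rewrite lee_fin normal_pdf_ge0.
- by rewrite lee_fin mulr_ge0 // sqr_ge0.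
Qed.

(** The interval has length [2 r s], and the density is at most its peak
    [1 / (s sqrt (2 pi)) <= 1 / s]. *)
Lemma normal_small_ball (m s r : R) : 0 < s -> 0 <= r ->
  (normal_prob m s `](m - r * s)%R, (m + r * s)%R[%classic <= (2 * r)%:E)%E.
Proof.
move=> s0 r0; rewrite /normal_prob.
have pk : normal_peak s * s <= 1.
  rewrite /normal_peak mulrC ler_pdivrMr; last first.
    by rewrite sqrtr_gt0 mulrn_wgt0 // mulr_gt0 ?pi_gt0 // exprn_gt0.
  rewrite mul1r -[leLHS](ger0_norm (ltW s0)) -sqrtr_sqr ler_wsqrtr //.
  rewrite -mulrnAr ler_peMr ?sqr_ge0 //; have := pi_ge2 R; lra.
apply: (@le_trans _ _
    (\int[mu]_(x in `](m - r * s)%R, (m + r * s)%R[) (normal_peak s)%:E)%E).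
  apply: ge0_le_integral => //=.
  - by move=> x _; rewrite lee_fin normal_pdf_ge0.
  - apply/measurable_EFinP/measurable_funTS; exact: measurable_normal_pdf.
  - by move=> x _; rewrite lee_fin normal_pdf_ub // gt_eqF.
rewrite integral_cst //= lebesgue_measure_itv /= lte_fin.
case: ifPn => _; last by rewrite mule0 lee_fin mulr_ge0.
rewrite -EFinD -EFinM lee_fin.
have -> : normal_peak s * (m + r * s - (m - r * s)) = 2 * r * (normal_peak s * s).
  by ring.
by rewrite ler_piMr // mulr_ge0.
Qed.

End Normal.

(** * Moments and tails of sums of squares of normal variables *)

Section Gaussian.
Context (R : realType) (d : measure_display) (T : measurableType d)
  (P : probability T R).

Lemma markov_le (f : T -> R) (a c : R) :
  measurable_fun setT f -> (forall w, 0 <= f w) -> 0 < a ->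
  (\int[P]_w (f w)%:E <= c%:E)%E ->
  (P [set w | (a <= f w)%R] <= (c / a)%:E)%E.
Proof.
move=> mf f0 a0 fc.
have := @le_integral_abse _ _ _ P setT measurableT (EFin \o f) a.
move=> /(_ (measurableT_comp _ mf) a0); rewrite setTI.
have -> : [set x | (a%:E <= `|(EFin \o f) x|)%E] = [set w | a <= f w].
  by apply/seteqP; split=> w /=; rewrite lee_fin ger0_norm.
have -> : (\int[P]_x `|(EFin \o f) x| = \int[P]_w (f w)%:E)%E.
  by apply: eq_integral => w _; rewrite /= ger0_norm.
move=> h; rewrite EFinM lee_pdivlMr // muleC.
by apply: le_trans fc; apply: h.
Qed.

Definition has_normal_law (z : T -> R) (m v : R) :=
  measurable_fun setT z /\
  forall A, measurable A -> P (z @^-1` A) = univ_normal m v A.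

Lemma has_normal_law_second_moment_le (z : T -> R) (m v : R) : 0 <= v ->
  has_normal_law z m v -> (\int[P]_w ((z w - m) ^+ 2)%:E <= (6 * v)%:E)%E.
Proof.
move=> v0 [mz hz].
pose X : {mfun T >-> measurableTypeR R} :=
  HB.pack z (isMeasurableFun.Build _ _ _ (measurableTypeR R) _ mz).
have msq : measurable_fun setT (fun x : R => ((x - m) ^+ 2)%:E).
  by apply/measurable_EFinP/measurable_funX; exact: measurable_funB.
have -> : (\int[P]_w ((z w - m) ^+ 2)%:E =
    \int[pushforward P X]_x ((x - m) ^+ 2)%:E)%E.
  rewrite ge0_integral_pushforward //.
  by move=> x _; rewrite lee_fin sqr_ge0.
(* Zero variance does occur, since a projection may have zero diagonal entries; the law is then the
   Dirac mass at [m]. *)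
have [v_eq0|v_neq0] := eqVneq v 0.
  have -> : (\int[pushforward P X]_x ((x - m) ^+ 2)%:E =
      \int[\d_(m : measurableTypeR R)]_x ((x - m) ^+ 2)%:E)%E.
    apply: eq_measure_integral.
    by move=> A mA _; have /= := hz A mA; rewrite /univ_normal v_eq0 eqxx.
  by rewrite integral_dirac // subrr expr0n /= mule0 v_eq0 mulr0.
have -> : (\int[pushforward P X]_x ((x - m) ^+ 2)%:E =
    \int[normal_prob m (Num.sqrt v)]_x ((x - m) ^+ 2)%:E)%E.
  apply: eq_measure_integral.
  by move=> A mA _; have /= := hz A mA; rewrite /univ_normal (negbTE v_neq0).
rewrite -[in leRHS](sqr_sqrtr v0).
by apply: normal_second_moment_le; rewrite sqrtr_eq0 -ltNge lt_def v_neq0.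
Qed.

Lemma has_normal_law_tail (z : T -> R) (m v t : R) : 0 <= v -> 0 < t ->
  has_normal_law z m v ->
  (P [set w | (t ^+ 2 <= (z w - m) ^+ 2)%R] <= (6 * v / t ^+ 2)%:E)%E.
Proof.
move=> v0 t0 hz; apply: markov_le.
- by apply: measurable_funX; apply: measurable_funB => //; case: hz.
- by move=> w; exact: sqr_ge0.
- by rewrite exprn_gt0.
- exact: has_normal_law_second_moment_le.
Qed.

Section Sum.
Variables (n : nat) (z : 'I_n -> T -> R) (v : 'I_n -> R).
Hypotheses (v0 : forall j, 0 <= v j) (hz : forall j, has_normal_law (z j) 0 (v j)).
Let V := \sum_j v j.
Hypothesis V0 : 0 < V.

Lemma measurable_sum_sqr : measurable_fun setT (fun w => \sum_j z j w ^+ 2).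
Proof.
by apply: measurable_sum => j; apply: measurable_funX; case: (hz j).
Qed.

Lemma sum_sqr_upper_tail (M : R) : 0 < M ->
  (P [set w | (M * V <= \sum_j z j w ^+ 2)%R] <= (6 / M)%:E)%E.
Proof.
move=> M0.
have -> : 6 / M = (6 * V) / (M * V).
  by field; rewrite !gt_eqF.
apply: markov_le; [exact: measurable_sum_sqr| |exact: mulr_gt0|].
  by move=> w; apply: sumr_ge0 => j _; exact: sqr_ge0.
under eq_integral do rewrite -sumEFin.
rewrite ge0_integral_sum //; last 2 first.
- by move=> j; apply/measurable_EFinP/measurable_funX; case: (hz j).
- by move=> j w _; rewrite lee_fin sqr_ge0.
rewrite /V mulr_sumr -sumEFin; apply: lee_sum => j _.
apply: le_trans (has_normal_law_second_moment_le (v0 j) (hz j)).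
by rewrite le_eqVlt; apply/orP; left; apply/eqP/eq_integral => w _; rewrite subr0.
Qed.

(* No independence is needed: by linearity of expectation the total variance of
   the coordinates falling in their small balls is at most a fraction [2 r] of
   [V] on average. *)
Lemma sum_sqr_lower_tail (r : R) : 0 < r ->
  (P [set w | (\sum_j z j w ^+ 2 < r ^+ 2 * V / 2)%R] <= (4 * r)%:E)%E.
Proof.
move=> r0.
pose s j := Num.sqrt (v j).
have s0 j : 0 <= s j by exact: sqrtr_ge0.
pose I j : set R := `](0 - r * s j), (0 + r * s j)[%classic.
pose A j := z j @^-1` I j.
have mA j : measurable (A j).
  rewrite /A -[X in measurable X]setTI; have [mz _] := hz j.
  exact: (mz measurableT _ (measurable_itv _)).
(* [f] is the total variance of the coordinates that fall in their small ball. The others contribute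
   at least [r ^+ 2 * (V - f w)] to the sum of squares, so a small sum forces [V / 2 <= f w];
   Markov's inequality for [f], of mean at most [2 r V], concludes. *)
pose f w := \sum_j v j * \1_(A j) w.
have mf : measurable_fun setT f.
  by apply: measurable_sum => j; apply: measurable_funM => //; exact: measurable_indic.
apply: (@le_trans _ _ (P [set w | (V / 2 <= f w)%R])).
  apply: le_measure; rewrite ?inE.
  - rewrite -[X in measurable X]setTI.
    have -> : [set w | \sum_j z j w ^+ 2 < r ^+ 2 * V / 2] =
      (fun w => \sum_j z j w ^+ 2) @^-1` `]-oo, (r ^+ 2 * V / 2)[%classic.
      by apply/seteqP; split=> w /=; rewrite in_itv.
    exact: measurable_sum_sqr.
  - rewrite -[X in measurable X]setTI.
    have -> : [set w | V / 2 <= f w] = f @^-1` `[(V / 2), +oo[%classic.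
      by apply/seteqP; split=> w /=; rewrite in_itv /= andbT.
    exact: mf.
  - move=> w /=; apply: contraTT; rewrite -ltNge -leNgt => fw.
    have h : r ^+ 2 * (V - f w) <= \sum_j z j w ^+ 2.
      rewrite /V /f -sumrB mulr_sumr; apply: ler_sum => j _.
      rewrite indicE; case: (boolP (w \in A j)) => wA.
        by rewrite mulr1 subrr mulr0 sqr_ge0.
      rewrite mulr0 subr0 -(sqr_sqrtr (v0 j)) -exprMn -/(s j).
      rewrite -(real_normK (num_real (z j w))) ler_pXn2r ?nnegrE ?mulr_ge0 ?(ltW r0) //.
      rewrite leNgt; apply: contra wA => zs; rewrite inE /A /I /= in_itv /=.
      by rewrite sub0r add0r -ltr_norml.
    apply: le_trans h; rewrite -mulrA ler_pM2l ?exprn_gt0 //; lra.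
have -> : 4 * r = (2 * r * V) / (V / 2) by field; rewrite gt_eqF.
apply: markov_le => //; last 2 first.
- by rewrite divr_gt0.
- rewrite /f; under eq_integral do rewrite -sumEFin.
  rewrite ge0_integral_sum //; last 2 first.
  + by move=> j; apply/measurable_EFinP/measurable_funM => //; exact: measurable_indic.
  + by move=> j w _; rewrite lee_fin mulr_ge0.
  rewrite /V mulr_sumr -sumEFin; apply: lee_sum => j _.
  under eq_integral do rewrite EFinM.
  rewrite ge0_integralZl //; last 2 first.
  + by apply/measurable_EFinP; exact: measurable_indic.
  + by rewrite lee_fin.
  rewrite integral_indic // setIT.
  have [->|vj] := eqVneq (v j) 0; first by rewrite mul0e mulr0.
  rewrite [in leRHS]mulrC EFinM lee_pmul2l // ?lte_fin ?lt_def ?vj ?v0 //.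
  have /= e := (hz j).2 (I j) (measurable_itv _).
  rewrite [leLHS]e.
  rewrite /univ_normal (negbTE vj); apply: normal_small_ball (ltW r0).
  by rewrite sqrtr_gt0 lt_def vj v0.
- by move=> w; apply: sumr_ge0 => j _; rewrite mulr_ge0.
Qed.

End Sum.
End Gaussian.

(** * The Bayes factor as a function of the residual ratio *)

Section BayesFactorFunction.
Variables (R : realType) (n i p : nat).
Hypotheses (ip : (i < p)%N) (pn : (p < n)%N).
Local Notation mu := (@lebesgue_measure R).

Definition bf_integrand (b phi : R) : R :=
  sin phi ^+ (p - i) *
  (n%:R + p.+1%:R * sin phi ^+ 2) `^ ((n%:R - p%:R) / 2) /
  (n%:R * b + p.+1%:R * sin phi ^+ 2) `^ ((n%:R - i%:R) / 2).

(** The data enter the Bayes factor only through the ratio [b]; isolating this real variable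
    separates the analysis of the integral from the probability estimates. *)
Definition bf_fun (b : R) : \bar R :=
  ((2 / pi * p.+1%:R `^ ((p%:R - i%:R) / 2))%:E *
   \int[mu]_(phi in `[0%R, (pi / 2)%R]) (bf_integrand b phi)%:E)%E.

Lemma measurable_bf_integrand b : measurable_fun setT (bf_integrand b).
Proof.
have ms : measurable_fun setT (@sin R).
  by apply: continuous_measurable_fun; exact: continuous_sin.
have -> : bf_integrand b = fun phi : R => sin phi ^+ (p - i) *
  (n%:R + p.+1%:R * sin phi ^+ 2) `^ ((n%:R - p%:R) / 2) *
  (n%:R * b + p.+1%:R * sin phi ^+ 2) `^ (- ((n%:R - i%:R) / 2)).
  by apply/funext => phi; rewrite powRN.
apply: measurable_funM; first apply: measurable_funM.
- exact: measurable_funX.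
- apply: (measurableT_comp (measurable_powR _)); apply: measurable_funD => //.
  by apply: measurable_funM => //; exact: measurable_funX.
- apply: (measurableT_comp (measurable_powR _)); apply: measurable_funD => //.
  by apply: measurable_funM => //; exact: measurable_funX.
Qed.

Lemma sin_ge0_pihalf (phi : R) : phi \in `[0, pi / 2] -> 0 <= sin phi.
Proof.
rewrite in_itv /= => /andP[h0 h1]; apply: sin_ge0_pi.
by rewrite h0 /= (le_trans h1) // ler_pdivrMr // ler_peMr ?pi_ge0 // ler1n.
Qed.

Lemma bf_integrand_ge0 b phi : phi \in `[0, pi / 2] -> 0 <= bf_integrand b phi.
Proof.
move=> /sin_ge0_pihalf s0.
by rewrite /bf_integrand divr_ge0 ?mulr_ge0 ?exprn_ge0 ?powR_ge0.
Qed.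

Lemma bf_const_ge0 : 0 <= 2 / pi * p.+1%:R `^ ((p%:R - i%:R) / 2) :> R.
Proof. by rewrite mulr_ge0 ?powR_ge0 // divr_ge0 // pi_ge0. Qed.

Lemma bf_fun_ge0 b : (0 <= bf_fun b)%E.
Proof.
apply: mule_ge0; first by rewrite lee_fin bf_const_ge0.
by apply: integral_ge0 => phi h; rewrite lee_fin bf_integrand_ge0.
Qed.

Let k2 : R := (p%:R - i%:R) / 2.
Let e1 : R := (n%:R - p%:R) / 2.
Let e2E : (n%:R - i%:R) / 2 = e1 + k2. Proof. by rewrite /e1 /k2; field. Qed.
Let k2_gt0 : 0 < k2. Proof. by rewrite divr_gt0 // subr_gt0 ltr_nat. Qed.
Let e1_gt0 : 0 < e1. Proof. by rewrite divr_gt0 // subr_gt0 ltr_nat. Qed.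
Let n_gt0 : 0 < n%:R :> R. Proof. by rewrite ltr0n (leq_ltn_trans _ pn). Qed.

Lemma bf_integrand_le b b' phi : 0 <= b -> b <= b' -> phi \in `[0, pi / 2] ->
  bf_integrand b' phi <= bf_integrand b phi.
Proof.
move=> b0 bb' /sin_ge0_pihalf; rewrite le_eqVlt => /predU1P[s0|s0].
  (* Where the sine vanishes, so does its power, as [i < p]. This disposes of [b = 0], where the
     denominator is 0 and its inverse is 0 by convention. *)
  by rewrite /bf_integrand -s0 expr0n subn_eq0 leqNgt ip !mul0r.
rewrite /bf_integrand ler_wpM2l ?mulr_ge0 ?exprn_ge0 ?powR_ge0 ?(ltW s0) //.
have D0 : 0 < n%:R * b + p.+1%:R * sin phi ^+ 2.
  by rewrite ltr_wpDl ?mulr_ge0 // mulr_gt0 ?exprn_gt0 // ltr0n.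
have D' : n%:R * b + p.+1%:R * sin phi ^+ 2 <= n%:R * b' + p.+1%:R * sin phi ^+ 2.
  by rewrite lerD2r ler_pM2l.
rewrite lef_pV2 ?posrE ?powR_gt0 ?(lt_le_trans D0 D') //.
rewrite ge0_ler_powR ?nnegrE ?(ltW D0) ?(le_trans (ltW D0) D') //.
by rewrite e2E addr_ge0 ?ltW.
Qed.

Lemma bf_fun_le b b' : 0 <= b -> b <= b' -> (bf_fun b' <= bf_fun b)%E.
Proof.
move=> b0 bb'; apply: lee_wpmul2l; first by rewrite lee_fin bf_const_ge0.
apply: ge0_le_integral => //=.
- by move=> phi h; rewrite lee_fin bf_integrand_ge0.
- by apply/measurable_EFinP/measurable_funTS; exact: measurable_bf_integrand.
- by apply/measurable_EFinP/measurable_funTS; exact: measurable_bf_integrand.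
- by move=> phi h; rewrite lee_fin bf_integrand_le.
Qed.

(** Since [bf_fun] is nonincreasing on the nonnegative reals, this set is an interval. This avoids
    proving that an integral depends measurably on its parameter. *)
Lemma measurable_bf_fun_gt (K : \bar R) :
  measurable [set b : R | 0 <= b /\ (K < bf_fun b)%E].
Proof.
apply: is_interval_measurable => x y [x0 Kx] [y0 Ky] z /andP[xz zy].
by split; [exact: le_trans xz|apply: lt_le_trans Ky (bf_fun_le _ zy); exact: le_trans xz].
Qed.

(** The denominator is split as [(n b + v)^e1 (n b + v)^k2]. The first power is compared with the
    numerator by [(n + v) / (n b + v) <= b^-1 <= exp (b^-1 - 1)], the second is at least [(n b)^k2],
    and the power of the sine is at most 1. *)
Lemma bf_integrand_ub b phi L : 0 < b -> b <= 1 ->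
  e1 * (b^-1 - 1) <= 2 * k2 * L -> phi \in `[0, pi / 2] ->
  bf_integrand b phi <= expR (2 * k2 * L) / (n%:R * b) `^ k2.
Proof.
move=> b0 b1 hL hphi; have s0 := sin_ge0_pihalf hphi.
rewrite /bf_integrand -/e1 e2E; set v := p.+1%:R * sin phi ^+ 2.
have v0 : 0 <= v by rewrite mulr_ge0 // exprn_ge0.
have nb : 0 < n%:R * b by rewrite mulr_gt0.
have D0 : 0 < n%:R * b + v by rewrite ltr_wpDr.
have nv : 0 <= n%:R + v by rewrite addr_ge0.
have h1 : (n%:R + v) `^ e1 <= expR (2 * k2 * L) * (n%:R * b + v) `^ e1.
  apply: (@le_trans _ _ ((b^-1 * (n%:R * b + v)) `^ e1)).
    apply: (ge0_ler_powR (ltW e1_gt0));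
      rewrite ?nnegrE ?mulr_ge0 ?invr_ge0 ?(ltW D0) ?(ltW b0) //.
    by rewrite mulrDr mulrCA mulVf ?gt_eqF // mulr1 lerD2l ler_peMl // invf_ge1.
  rewrite powRM ?invr_ge0 ?(ltW D0) ?(ltW b0) // ler_wpM2r ?powR_ge0 //.
  apply: (@le_trans _ _ (expR (b^-1 - 1) `^ e1)); last first.
    by rewrite -expRM ler_expR mulrC.
  apply: (ge0_ler_powR (ltW e1_gt0)); rewrite ?nnegrE ?invr_ge0 ?expR_ge0 ?(ltW b0) //.
  by have := expR_ge1Dx (b^-1 - 1); rewrite addrC subrK.
have h2 : (n%:R * b) `^ k2 <= (n%:R * b + v) `^ k2.
  by apply: (ge0_ler_powR (ltW k2_gt0)); rewrite ?nnegrE ?(ltW D0) ?(ltW nb) // ler_wpDr.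
rewrite powRD ?(gt_eqF D0) ?implybT // ler_pdivrMr ?mulr_gt0 ?powR_gt0 //.
apply: (@le_trans _ _ ((n%:R + v) `^ e1)).
  by rewrite ler_piMl ?powR_ge0 // exprn_ile1 // sin_le1.
apply: (le_trans h1).
rewrite mulrACA ler_peMr ?mulr_ge0 ?expR_ge0 ?powR_ge0 // mulrC.
by rewrite ler_pdivlMr ?powR_gt0 // mul1r.
Qed.

Lemma bf_fun_ub b L : 0 < b -> b <= 1 -> e1 * (b^-1 - 1) <= 2 * k2 * L ->
  (bf_fun b <= ((p.+1%:R / (n%:R * b) * expR (2 * L)) `^ k2)%:E)%E.
Proof.
move=> b0 b1 hL; rewrite /bf_fun -/k2.
have nb : 0 < n%:R * b by rewrite mulr_gt0.
have pi0 := pi_gt0 R.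
have pih : 0 < pi / 2 :> R by rewrite divr_gt0.
set c := expR (2 * k2 * L) / (n%:R * b) `^ k2.
have h : (\int[mu]_(phi in `[0%R, (pi / 2)%R]) (bf_integrand b phi)%:E <=
    (c * (pi / 2))%:E)%E.
  apply: (@le_trans _ _ (\int[mu]_(phi in `[0%R, (pi / 2)%R]) c%:E)%E).
    apply: ge0_le_integral => //=.
    - by move=> phi ?; rewrite lee_fin bf_integrand_ge0.
    - by apply/measurable_EFinP/measurable_funTS; exact: measurable_bf_integrand.
    - by move=> phi ?; rewrite lee_fin bf_integrand_ub.
  by rewrite integral_cst //= lebesgue_measure_itv /= lte_fin pih sube0.
apply: (le_trans (lee_wpmul2l _ h)); first by rewrite lee_fin bf_const_ge0.
rewrite -EFinM lee_fin powRM ?expR_ge0 ?divr_ge0 ?(ltW nb) //.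
rewrite powRM ?invr_ge0 ?(ltW nb) // -expRM.
have -> : (n%:R * b)^-1 `^ k2 = ((n%:R * b) `^ k2)^-1.
  by rewrite -[(n%:R * b)^-1]powR_inv1 ?(ltW nb) // -powRrM mulN1r powRN.
(* The length [pi / 2] of the domain cancels the prefactor [2 / pi], so equality holds here. *)
rewrite le_eqVlt; apply/orP; left; apply/eqP; rewrite /c.
have -> : 2 * L * k2 = 2 * k2 * L by ring.
move: {+}(@pi R) pi0 => q q0.
by field; rewrite (gt_eqF q0) gt_eqF ?powR_gt0.
Qed.

Lemma sqr_sin_ge_half (phi : R) : phi \in `[pi / 4, pi / 2] ->
  2^-1 <= sin phi ^+ 2.
Proof.
have pi0 := pi_gt0 R.
rewrite in_itv /= => /andP[h0 h1].
have -> : 2^-1 = sin (pi / 4) ^+ 2 :> R.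
  have := cos_mulr2n (pi / 4 : R); have := cos2Dsin2 (pi / 4 : R).
  have -> : (pi / 4) *+ 2 = pi / 2 :> R by field.
  by rewrite cos_pihalf mulr2n; lra.
have hs : sin (pi / 4) <= sin phi.
  have [->//|ne] := eqVneq (pi / 4) phi.
  apply/ltW; rewrite ltr_sin ?in_itv /=; first by rewrite lt_def eq_sym ne.
  - by apply/andP; split; lra.
  - by apply/andP; split; lra.
have s0 : 0 <= sin (pi / 4 : R).
  by apply: sin_ge0_pihalf; rewrite in_itv /=; apply/andP; split; lra.
by rewrite ler_pXn2r ?nnegrE ?(le_trans s0).
Qed.

(** From [exp (- eta / 4) >= 1 - eta / 4] and [(1 - eta / 4) (1 + eta / 2) >= 1]. *)
Lemma expR_quarter_le (eta : R) : 0 <= eta <= 1 -> expR (eta / 4) <= 1 + eta / 2.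
Proof.
move=> /andP[h0 h1]; rewrite -[leLHS]invrK -expRN.
have h := expR_ge1Dx (- (eta / 4)).
apply: (@le_trans _ _ (1 - eta / 4)^-1).
  by rewrite lef_pV2 ?posrE ?expR_gt0 //; lra.
by rewrite -div1r ler_pdivrMr; nra.
Qed.

(** As [v <= n], [(1 + eta / 2) (n (1 - eta) + v) <= n + v], so the ratio raised to [e1] is at least
    [exp (eta / 4)]. The rest is at least [(4 n)^(- k2)], because [sin^2 phi >= 1/2] and
    [n b + v <= 2 n]. *)
Lemma bf_integrand_lb b phi eta : 0 <= eta <= 1 -> 0 <= b -> b <= 1 - eta ->
  phi \in `[pi / 4, pi / 2] ->
  expR (eta / 4 * e1) / (4 * n%:R) `^ k2 <= bf_integrand b phi.
Proof.
move=> eta01 b0 b1 hphi; have pi0 := pi_gt0 R.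
have /andP[eta0 eta1] := eta01.
have hs := sqr_sin_ge_half hphi.
have s0 : 0 <= sin phi.
  move: hphi; rewrite in_itv /= => /andP[h0 h1].
  by apply: sin_ge0_pihalf; rewrite in_itv /=; apply/andP; split; lra.
have s1 : sin phi ^+ 2 <= 1 by rewrite expr_le1 // sin_le1.
rewrite /bf_integrand -/e1 e2E.
have -> : sin phi ^+ (p - i) = (sin phi ^+ 2) `^ k2.
  rewrite -powR_mulrn // -(powR_mulrn 2) // -powRrM natrB ?(ltnW ip) //.
  by congr (_ `^ _); rewrite /k2; field.
set s := sin phi ^+ 2 in hs s1 *.
set v := p.+1%:R * s.
have v0 : 0 < v by rewrite mulr_gt0 ?ltr0n //; lra.
(* The strict inequality [p < n] is what makes [p + 1 <= n]. *)
have vn : v <= n%:R.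
  by apply: (@le_trans _ _ p.+1%:R); [rewrite ler_piMr | rewrite ler_nat].
have D0 : 0 < n%:R * b + v by rewrite ltr_wpDl ?mulr_ge0.
have h1 : expR (eta / 4 * e1) * (n%:R * b + v) `^ e1 <= (n%:R + v) `^ e1.
  rewrite expRM -powRM ?expR_ge0 ?(ltW D0) //.
  apply: (ge0_ler_powR (ltW e1_gt0));
      rewrite ?nnegrE ?mulr_ge0 ?expR_ge0 ?(ltW D0) ?addr_ge0 ?(ltW v0) //.
  apply: (@le_trans _ _ ((1 + eta / 2) * (n%:R * (1 - eta) + v))).
    apply: ler_pM; rewrite ?expR_ge0 ?(ltW D0) ?expR_quarter_le //.
    by rewrite lerD2r ler_pM2l.
  have := mulr_ge0 eta0 (ltW n_gt0).
  have : 0 <= eta * (n%:R - v) by rewrite mulr_ge0 // subr_ge0.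
  have : 0 <= eta * (eta * n%:R) by rewrite !mulr_ge0.
  nra.
have h2 : (n%:R * b + v) `^ k2 <= (2 * n%:R) `^ k2.
  apply: (ge0_ler_powR (ltW k2_gt0)); rewrite ?nnegrE ?mulr_ge0 ?(ltW D0) //.
  by have : n%:R * b <= n%:R * 1 by [rewrite ler_pM2l //; lra]; lra.
have h3 : (4 * n%:R : R) `^ k2 * s `^ k2 >= (2 * n%:R) `^ k2.
  rewrite -powRM ?mulr_ge0 ?(le_trans _ hs) //.
  apply: (ge0_ler_powR (ltW k2_gt0)); rewrite ?nnegrE ?mulr_ge0 ?(le_trans _ hs) //.
  by have : n%:R * 2^-1 <= n%:R * s by [rewrite ler_pM2l]; lra.
rewrite powRD ?(gt_eqF D0) ?implybT //.
rewrite ler_pdivlMr ?mulr_gt0 ?powR_gt0 //.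
rewrite mulrAC ler_pdivrMr ?powR_gt0 ?mulr_gt0 //.
set E := expR _ in h1 *.
rewrite mulrA.
have -> : s `^ k2 * (n%:R + v) `^ e1 * (4 * n%:R) `^ k2 =
  (n%:R + v) `^ e1 * ((4 * n%:R) `^ k2 * s `^ k2) by ring.
apply: ler_pM => //; rewrite ?mulr_ge0 ?expR_ge0 ?powR_ge0 //.
exact: le_trans h3.
Qed.

Lemma bf_fun_lb b eta : 0 <= eta <= 1 -> 0 <= b -> b <= 1 - eta ->
  ((2^-1 * (expR (eta / 4 * e1) / (4 * n%:R) `^ k2))%:E <= bf_fun b)%E.
Proof.
move=> eta01 b0 b1; rewrite /bf_fun -/k2.
have pi0 := pi_gt0 R.
set c := expR (eta / 4 * e1) / (4 * n%:R) `^ k2.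
have c0 : 0 <= c by rewrite divr_ge0 ?expR_ge0 ?powR_ge0.
have h : ((c * (pi / 4))%:E <=
    \int[mu]_(phi in `[0%R, (pi / 2)%R]) (bf_integrand b phi)%:E)%E.
  (* Only the half of the domain where the sine is large is kept; its length [pi / 4] against
     [2 / pi] leaves the factor [1/2]. *)
  apply: (@le_trans _ _ (\int[mu]_(phi in `[(pi / 4)%R, (pi / 2)%R])
    (bf_integrand b phi)%:E)%E); last first.
    apply: ge0_subset_integral => //=.
    - by apply/measurable_EFinP/measurable_funTS; exact: measurable_bf_integrand.
    - by move=> phi ?; rewrite lee_fin bf_integrand_ge0.
    - by apply: subset_itvr; rewrite bnd_simp; lra.
  apply: (@le_trans _ _ (\int[mu]_(phi in `[(pi / 4)%R, (pi / 2)%R]) c%:E)%E).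
    rewrite integral_cst //= lebesgue_measure_itv /= lte_fin ifT; last by lra.
    by rewrite -EFinB -EFinM lee_fin ler_wpM2l //; lra.
  apply: ge0_le_integral => //=.
  - by apply/measurable_EFinP/measurable_funTS; exact: measurable_bf_integrand.
  - by move=> phi ?; rewrite lee_fin; apply: bf_integrand_lb.
apply: le_trans (lee_wpmul2l _ h); last by rewrite lee_fin bf_const_ge0.
rewrite -EFinM lee_fin.
have P1 : 1 <= p.+1%:R `^ k2 :> R.
  by rewrite -[leLHS](powRr0 p.+1%:R) ler_powR ?ler1n // ltW.
have -> : 2 / pi * p.+1%:R `^ k2 * (c * (pi / 4)) = 2^-1 * c * p.+1%:R `^ k2.
  by move: {+}(@pi R) pi0 => q q0; field; rewrite gt_eqF.
by rewrite ler_peMr // mulr_ge0.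
Qed.

End BayesFactorFunction.

(** * Tails of the Bayes factor *)

Section NormalVector.
Context (R : realType) (d : measure_display) (T : measurableType d)
  (P : probability T R) (n : nat) (y : T -> 'cV[R]_n) (mu : 'cV[R]_n) (s : R).
Hypothesis s0 : 0 < s.
Hypothesis hy : normal_vector P y mu (s ^+ 2)%:M.

Lemma measurable_linear_form (t : 'cV[R]_n) :
  measurable_fun setT (fun w => (t^T *m y w) 0 0).
Proof.
have -> : (fun w => (t^T *m y w) 0 0) = fun w => \sum_j t j 0 * y w j 0.
  by apply/funext => w; rewrite mxE; apply: eq_bigr => j _; rewrite mxE.
by apply: measurable_sum => j; apply: measurable_funM => //; exact: hy.1.
Qed.

Lemma has_normal_law_linear_form (t : 'cV[R]_n) :
  has_normal_law P (fun w => (t^T *m y w) 0 0) ((t^T *m mu) 0 0)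
    (s ^+ 2 * (t^T *m t) 0 0).
Proof.
split; first exact: measurable_linear_form.
move=> A mA; rewrite [LHS](hy.2 t A mA); congr univ_normal.
by rewrite mul_mx_scalar -scalemxAl mxE.
Qed.

Variable A : 'M[R]_n.
Hypotheses (pA : orthoproj A) (Amu : A *m mu = 0).

Let row_form (x : 'cV[R]_n) j : (A *m x) j 0 = (((row j A)^T)^T *m x) 0 0.
Proof.
by rewrite trmxK mxE [RHS]mxE; apply: eq_bigr => k _; rewrite [in RHS]mxE.
Qed.

Let row_norm j : (((row j A)^T)^T *m (row j A)^T) 0 0 = A j j.
Proof.
rewrite -row_form; have [tA iA] := pA.
by rewrite -[in RHS]iA !mxE; apply: eq_bigr => k _; rewrite -[in A k j]tA !mxE.
Qed.

(** Coordinate [j] of [A y] is the linear form given by row [j] of [A], of squared norm [A j j]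
    because [A A' = A]; it is centred because [A mu = 0]. The variances therefore add up to
    [s ^+ 2 * \tr A]. *)
Let law j : has_normal_law P (fun w => (A *m y w) j 0) 0 (s ^+ 2 * A j j).
Proof.
have -> : (fun w => (A *m y w) j 0) = fun w => (((row j A)^T)^T *m y w) 0 0.
  by apply/funext => w; rewrite row_form.
have := has_normal_law_linear_form (row j A)^T.
by rewrite row_norm -row_form Amu mxE.
Qed.

Let diag_ge0 j : 0 <= s ^+ 2 * A j j.
Proof. by rewrite mulr_ge0 ?sqr_ge0 // -row_norm trmx_mul_self_ge0. Qed.

Lemma measurable_quad : measurable_fun setT (fun w => ((y w)^T *m A *m y w) 0 0).
Proof.
under eq_fun do rewrite quad_orthoproj //.
exact: measurable_sum_sqr law.
Qed.

Hypothesis trA : 0 < \tr A.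

Let sum_var : \sum_j s ^+ 2 * A j j = s ^+ 2 * \tr A.
Proof. by rewrite -mulr_sumr. Qed.

Let sum_var_gt0 : 0 < \sum_j s ^+ 2 * A j j.
Proof. by rewrite sum_var mulr_gt0 ?exprn_gt0. Qed.

Lemma quad_upper_tail (M : R) : 0 < M ->
  (P [set w | (M * (s ^+ 2 * \tr A) <= ((y w)^T *m A *m y w) 0 0)%R]
   <= (6 / M)%:E)%E.
Proof.
move=> M0; have := sum_sqr_upper_tail diag_ge0 law sum_var_gt0 M0.
by rewrite sum_var; under eq_set do rewrite -quad_orthoproj //.
Qed.

Lemma quad_lower_tail (r : R) : 0 < r ->
  (P [set w | (((y w)^T *m A *m y w) 0 0 < r ^+ 2 * (s ^+ 2 * \tr A) / 2)%R]
   <= (4 * r)%:E)%E.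
Proof.
move=> r0; have := sum_sqr_lower_tail diag_ge0 law sum_var_gt0 r0.
by rewrite sum_var; under eq_set do rewrite -quad_orthoproj //.
Qed.

End NormalVector.

(** * Nonasymptotic bounds for the Bayes factor under each model *)

Section Regression.
Context (R : realType) (n i p : nat) (X : 'M[R]_(n, p)) (c : 'I_i -> 'I_p)
  (d : measure_display) (T : measurableType d) (P : probability T R)
  (y : T -> 'cV[R]_n) (s : R).
Hypotheses (ip : (i < p)%N) (pn : (p < n)%N).
Hypotheses (rX : \rank X = p) (ic : injective c) (s0 : 0 < s).
Let Xi := colsub c X.
Let D := hat_mx X - hat_mx Xi.
Let pD : orthoproj D := orthoproj_hatB rX ic.
Let pQ : orthoproj (1%:M - hat_mx X) := orthoproj_residual rX.
Let qD w := ((y w)^T *m D *m y w) 0 0.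

Let rss_ge0 w : 0 <= rss X (y w).
Proof. exact: quad_orthoproj_ge0. Qed.

Let qD_ge0 w : 0 <= qD w.
Proof. exact: quad_orthoproj_ge0. Qed.

Let ratioE w : rss_ratio Xi X (y w) = rss X (y w) / (rss X (y w) + qD w).
Proof. by rewrite /rss_ratio /Xi rss_colsub. Qed.

Let ratio_ge0 w : 0 <= rss_ratio Xi X (y w).
Proof. by rewrite ratioE divr_ge0 ?addr_ge0. Qed.

Let bfE w : bayes_factor Xi X (y w) = bf_fun n i p (rss_ratio Xi X (y w)).
Proof. by []. Qed.

Let trD : 0 < \tr D.
Proof. by rewrite mxtrace_hatB // subr_gt0 ltr_nat. Qed.

Let trQ : 0 < \tr (1%:M - hat_mx X).
Proof. by rewrite mxtrace_residual // subr_gt0 ltr_nat. Qed.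

Section Measurability.
Variable mu : 'cV[R]_n.
Hypothesis hy : normal_vector P y mu (s ^+ 2)%:M.

Lemma measurable_rss : measurable_fun setT (fun w => rss X (y w)).
Proof.
rewrite /rss; under eq_fun do rewrite quad_orthoproj //.
apply: measurable_sum => j; apply: measurable_funX.
under eq_fun do rewrite mxE.
by apply: measurable_sum => k; apply: measurable_funM => //; exact: hy.1.
Qed.

Lemma measurable_bayes_factor_gt (K : \bar R) :
  measurable [set w | (K < bayes_factor Xi X (y w))%E].
Proof.
have mqD : measurable_fun setT qD.
  rewrite /qD; under eq_fun do rewrite quad_orthoproj //.
  apply: measurable_sum => j; apply: measurable_funX.
  under eq_fun do rewrite mxE.
  by apply: measurable_sum => k; apply: measurable_funM => //; exact: hy.1.
have mr : measurable_fun setT (fun w => rss_ratio Xi X (y w)).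
  (* Inversion is written as the power [-1] to use the measurability of [powR]; on nonnegative reals
     the two agree, 0 included. *)
  have -> : (fun w => rss_ratio Xi X (y w)) =
      fun w => rss X (y w) * (rss X (y w) + qD w) `^ (- 1).
    by apply/funext => w; rewrite ratioE powR_inv1 // addr_ge0.
  apply: measurable_funM; first exact: measurable_rss.
  apply: (measurableT_comp (measurable_powR _)).
  by apply: measurable_funD => //; exact: measurable_rss.
have -> : [set w | (K < bayes_factor Xi X (y w))%E] =
    (fun w => rss_ratio Xi X (y w)) @^-1` [set b | 0 <= b /\ (K < bf_fun n i p b)%E].
  by apply/seteqP; split=> w /=; rewrite -bfE; [split|case].
by rewrite -[X in measurable X]setTI; apply: mr => //; exact: measurable_bf_fun_gt.
Qed.

End Measurability.

Let measureU_le (A B C : set T) : measurable A -> measurable B -> measurable C ->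
  A `<=` B `|` C -> (P A <= P B + P C)%E.
Proof.
move=> mA mB mC ABC; apply: le_trans (measureU2 _ mB mC).
by apply: le_measure; rewrite ?inE //; exact: measurableU.
Qed.

Let measurable_ge (f : T -> R) (x : R) : measurable_fun setT f ->
  measurable [set w | x <= f w].
Proof.
move=> mf; rewrite -[X in measurable X]setTI.
have -> : [set w | x <= f w] = f @^-1` `[x, +oo[%classic.
  by apply/seteqP; split=> w /=; rewrite in_itv /= andbT.
exact: mf.
Qed.

Let measurable_lt (f : T -> R) (x : R) : measurable_fun setT f ->
  measurable [set w | f w < x].
Proof.
move=> mf; rewrite -[X in measurable X]setTI.
have -> : [set w | f w < x] = f @^-1` `]-oo, x[%classic.
  by apply/seteqP; split=> w /=; rewrite in_itv.
exact: mf.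
Qed.

(** The two error terms are the probabilities that [rss X] is too small and that [qD] is too large.
    Outside these events [b^-1 - 1] is at most [2 L (p - i) / (n - p) <= 1]; hence [b^-1 <= 2], the
    source of the factor 2 in [q]. *)
Lemma bayes_factor_null_tail (alpha : 'cV[R]_i) (r M eps : R) :
  let L := M / r ^+ 2 in
  let q := 2 * p.+1%:R / n%:R * expR (2 * L) in
  normal_vector P y (Xi *m alpha) (s ^+ 2)%:M ->
  0 < r -> 0 < M -> 0 < eps ->
  2 * (p%:R - i%:R) * L <= n%:R - p%:R -> q <= 1 -> q <= eps ^+ 2 ->
  (P [set w | (eps%:E < `|bayes_factor Xi X (y w)|)%E] <= (4 * r + 6 / M)%:E)%E.
Proof.
move=> L q hy r0 M0 eps0 hL q1 qe.
have -> : [set w | (eps%:E < `|bayes_factor Xi X (y w)|)%E] =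
    [set w | (eps%:E < bayes_factor Xi X (y w))%E].
  by apply/seteqP; split=> w /=; rewrite bfE gee0_abs ?bf_fun_ge0.
have Qmu : (1%:M - hat_mx X) *m (Xi *m alpha) = 0.
  by rewrite mulmxA residual_mulmx_colsub // mul0mx.
have Dmu : D *m (Xi *m alpha) = 0.
  by rewrite mulmxA hatB_mulmx_colsub // mul0mx.
have hB := quad_lower_tail s0 hy pQ Qmu trQ r0.
have hC := quad_upper_tail s0 hy pD Dmu trD M0.
rewrite EFinD; apply: le_trans (leeD hB hC); apply: measureU_le.
- exact: measurable_bayes_factor_gt hy _.
- exact: (measurable_lt _ (measurable_quad hy pQ Qmu)).
- exact: (measurable_ge _ (measurable_quad hy pD Dmu)).
move=> w /= hw; apply/orP; rewrite -[_ || _]negbK negb_or -leNgt -ltNge.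
apply/negP => /andP[]; rewrite mxtrace_residual // mxtrace_hatB // => h1 h2.
move: hw; apply/negP; rewrite -leNgt bfE.
have h1' : r ^+ 2 * (s ^+ 2 * (n%:R - p%:R)) / 2 <= rss X (y w) := h1.
have h2' : qD w < M * (s ^+ 2 * (p%:R - i%:R)) := h2.
have np0 : 0 < n%:R - p%:R :> R by rewrite subr_gt0 ltr_nat.
have pi0 : 0 < p%:R - i%:R :> R by rewrite subr_gt0 ltr_nat.
have n0 : 0 < n%:R :> R by rewrite ltr0n (leq_ltn_trans _ pn).
have r2 : 0 < r ^+ 2 by rewrite exprn_gt0.
have s2 : 0 < s ^+ 2 by rewrite exprn_gt0.
have rss0 : 0 < rss X (y w) by apply: lt_le_trans h1'; rewrite divr_gt0 ?mulr_gt0.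
have L0 : 0 < L by rewrite divr_gt0.
have hDr : qD w / rss X (y w) <= 2 * L * (p%:R - i%:R) / (n%:R - p%:R).
  rewrite ler_pdivrMr //.
  apply: (@le_trans _ _ (2 * L * (p%:R - i%:R) / (n%:R - p%:R) *
    (r ^+ 2 * (s ^+ 2 * (n%:R - p%:R)) / 2))).
    rewrite (le_trans (ltW h2')) // le_eqVlt; apply/orP; left; apply/eqP.
    by rewrite /L; field; rewrite !gt_eqF.
  by rewrite ler_pM2l // divr_gt0 // mulr_gt0 // mulr_gt0.
set b := rss_ratio _ _ _.
have bV : b^-1 = 1 + qD w / rss X (y w).
  by rewrite /b ratioE; field; rewrite !gt_eqF // ltr_wpDr.
have b0 : 0 < b by rewrite -invr_gt0 bV ltr_wpDr // divr_ge0.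
have b1 : b <= 1 by rewrite -invf_ge1 // bV lerDl divr_ge0.
have bV2 : b^-1 <= 2.
  have : 2 * L * (p%:R - i%:R) / (n%:R - p%:R) <= 1.
    by rewrite ler_pdivrMr // mul1r mulrAC.
  by rewrite bV; lra.
have hb : (n%:R - p%:R) / 2 * (b^-1 - 1) <= 2 * ((p%:R - i%:R) / 2) * L.
  rewrite bV addrAC subrr add0r.
  have -> : 2 * ((p%:R - i%:R) / 2) * L =
    (n%:R - p%:R) / 2 * (2 * L * (p%:R - i%:R) / (n%:R - p%:R)).
    by field; rewrite gt_eqF.
  by rewrite ler_pM2l // divr_gt0.
apply: (le_trans (bf_fun_ub ip pn b0 b1 hb)); rewrite lee_fin.
have q0 : 0 < q by rewrite mulr_gt0 ?expR_gt0 // divr_gt0 // mulr_gt0 // ltr0n.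
have hq : p.+1%:R / (n%:R * b) * expR (2 * L) <= q.
  rewrite /q ler_pM2r ?expR_gt0 // invfM.
  have -> : 2 * p.+1%:R / n%:R = p.+1%:R * (n%:R^-1 * 2) :> R by ring.
  by rewrite ler_wpM2l // ler_wpM2l ?invr_ge0 // ltW.
apply: (@le_trans _ _ (q `^ ((p%:R - i%:R) / 2))).
  apply: ge0_ler_powR => //; rewrite ?nnegrE ?(ltW q0) ?divr_ge0 ?(ltW pi0) //.
  by rewrite mulr_ge0 ?expR_ge0 // divr_ge0 // mulr_ge0 // ltW.
(* The exponent is at least [1/2] since [p - i >= 1], and [q <= 1], so the square root of [q] is the
   worst case; it is at most [eps]. *)
apply: (@le_trans _ _ (q `^ 2^-1)).
  have := @ger_powR R q; rewrite q0 q1 => /(_ isT); apply.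
  rewrite -[leLHS]mul1r ler_pM2r // lerBrDr.
  by rewrite nat1r ler_nat.
by rewrite powR12_sqrt ?(ltW q0) // -[leRHS](ger0_norm (ltW eps0)) -sqrtr_sqr ler_wsqrtr.
Qed.

(** Let [g] be the projected mean and [G] its squared norm, at least [s^2 n delta]. Outside the tail
    events [rss X < M s^2 n] and [g' y > 3 G / 4], so [qD >= 2 g' y - G >= G / 2]. Then
    [b <= M / (M + delta / 2) = 1 - eta]. *)
Lemma bayes_factor_alternative_tail (beta : 'cV[R]_p) (delta M K : R) :
  let eta := (delta / 2) / (M + delta / 2) in
  normal_vector P y (X *m beta) (s ^+ 2)%:M ->
  0 < delta -> 0 < M -> delta <= model_distance Xi X beta s ->
  K < 2^-1 * (expR (eta / 4 * ((n%:R - p%:R) / 2)) /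
              (4 * n%:R) `^ ((p%:R - i%:R) / 2)) ->
  (P (~` [set w | (K%:E < bayes_factor Xi X (y w))%E])
   <= (6 / M + 96 / (n%:R * delta))%:E)%E.
Proof.
move=> eta hy delta0 M0 hdelta hK.
have n0 : 0 < n%:R :> R by rewrite ltr0n (leq_ltn_trans _ pn).
have s2 : 0 < s ^+ 2 by rewrite exprn_gt0.
have Qmu : (1%:M - hat_mx X) *m (X *m beta) = 0.
  by rewrite mulmxA residual_mulmx // mul0mx.
set g := D *m (X *m beta).
set G := (g^T *m g) 0 0.
have Dg : D *m g = g by rewrite /g mulmxA; case: pD => _ ->.
have hG : s ^+ 2 * n%:R * delta <= G.
  move: hdelta; rewrite model_distanceE // -/D -/g -/G mulrA -invfM mulrC.
  by rewrite ler_pdivlMr ?mulr_gt0 // mulrC.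
have G0 : 0 < G by apply: lt_le_trans hG; rewrite !mulr_gt0.
have gmu : (g^T *m (X *m beta)) 0 0 = G.
  rewrite /G; congr (fun_of_matrix _ 0 0).
  have gD : g^T *m D = g^T.
    by have [tD _] := pD; rewrite -[in RHS]Dg (trmx_mul D g) tD.
  by rewrite -[in LHS]gD -mulmxA.
have hB := quad_upper_tail s0 hy pQ Qmu trQ M0.
have hlaw := has_normal_law_linear_form hy g.
rewrite gmu -/G in hlaw.
have G4 : 0 < G / 4 by rewrite divr_gt0.
have hC := has_normal_law_tail (mulr_ge0 (ltW s2) (ltW G0)) G4 hlaw.
(* The constant is [96 = 6 * 4^2]: the form [g' y] has mean [G] and variance [s^2 G], and a
   deviation of [G / 4] is allowed. *)
have hC' : 6 * (s ^+ 2 * G) / (G / 4) ^+ 2 <= 96 / (n%:R * delta).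
  have -> : 6 * (s ^+ 2 * G) / (G / 4) ^+ 2 = 96 * (s ^+ 2 / G).
    by field; rewrite gt_eqF.
  rewrite ler_pM2l // ler_pdivrMr // mulrC ler_pdivlMr ?mulr_gt0 //.
  by rewrite mulrA.
rewrite -lee_fin in hC'.
rewrite EFinD; apply: le_trans (leeD hB (le_trans hC hC')); apply: measureU_le.
- by apply: measurableC; exact: measurable_bayes_factor_gt hy _.
- exact: (measurable_ge _ (measurable_quad hy pQ Qmu)).
- apply: measurable_ge; apply: measurable_funX; apply: measurable_funB => //.
  exact: measurable_linear_form hy g.
move=> w /= hw; apply/orP; rewrite -[_ || _]negbK negb_or -!ltNge.
apply/negP => /andP[]; rewrite mxtrace_residual // => h1 h2; apply: hw.
have h1' : rss X (y w) < M * (s ^+ 2 * (n%:R - p%:R)) := h1.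
have hg : 3 / 4 * G < (g^T *m y w) 0 0.
  move: h2; rewrite -[X in X < _]real_normK ?num_real // ltr_pXn2r ?nnegrE ?(ltW G4) //.
  by rewrite ltr_norml => /andP[]; lra.
have hq : G / 2 <= qD w.
  by have := quad_orthoproj_ge (y w) pD Dg; rewrite -/(qD w) -/G; lra.
have d2 : 0 < M + delta / 2 by rewrite addr_gt0 // divr_gt0.
have eta01 : 0 <= eta <= 1.
  apply/andP; split; last by rewrite /eta ler_pdivrMr // mul1r lerDr ltW.
  by rewrite divr_ge0 ?(ltW d2) // divr_ge0 // ltW.
have hb : rss_ratio Xi X (y w) <= 1 - eta.
  have q0 : 0 < qD w by lra.
  rewrite ratioE ler_pdivrMr ?ltr_wpDl //.
  have hr : rss X (y w) <= M * (s ^+ 2 * n%:R).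
    apply: (le_trans (ltW h1')); rewrite ler_pM2l // ler_pM2l // gerBl //.
  have hm : delta / 2 * rss X (y w) <= M * qD w.
    apply: (@le_trans _ _ (delta / 2 * (M * (s ^+ 2 * n%:R)))).
      by rewrite ler_pM2l // divr_gt0.
    have -> : delta / 2 * (M * (s ^+ 2 * n%:R)) = M * (s ^+ 2 * n%:R * delta / 2).
      by field.
    by rewrite ler_pM2l //; lra.
  suff : eta * (rss X (y w) + qD w) <= qD w by lra.
  by rewrite /eta mulrAC ler_pdivrMr //; lra.
rewrite bfE; apply: lt_le_trans (bf_fun_lb ip pn eta01 (ratio_ge0 w) hb).
by rewrite lte_fin.
Qed.

End Regression.

(** * Growth comparisons for the dimension *)

(** * Asymptotics *)

Section Asymptotics.
Variable R : realType.

Lemma cvge_near_le (u : nat -> \bar R) (l : R) :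
  (forall e : R, 0 < e ->
     \forall n \near \oo, ((l - e)%:E <= u n <= (l + e)%:E)%E) ->
  u n @[n --> \oo] --> l%:E.
Proof.
move=> h.
have fin x e : ((l - e)%:E <= u x <= (l + e)%:E)%E -> u x \is a fin_num.
  move=> /andP[h1 h2]; rewrite fin_numE gt_eqF ?lt_eqF //.
    exact: le_lt_trans h2 (ltry _).
  exact: lt_le_trans (ltNyr _) h1.
apply/fine_cvgP; split.
  by near=> x; apply: (@fin x 1); near: x; exact: h.
apply/cvgrPdist_le => e e0; near=> x.
have hx : ((l - e)%:E <= u x <= (l + e)%:E)%E by near: x; exact: h.
have fx := fin _ _ hx.
move: hx; rewrite -(fineK fx) !lee_fin /= => /andP[h1 h2].
by rewrite ler_norml; apply/andP; split; lra.
Unshelve. all: by end_near.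
Qed.

(** With [g = (1 - b) / 2], [n = n^b n^g n^g]. One factor [n^g] pays for the logarithm, as
    [g ln (4 n) < (4 n)^g], and the other eventually exceeds the constant [C' / e]. *)
Lemma mul_ln_little (p : nat -> nat) (b : R) : b < 1 ->
  (fun n : nat => (p n)%:R : R) =O_\oo (fun n : nat => n%:R `^ b : R) ->
  forall e : R, 0 < e ->
  \forall n \near \oo, (p n)%:R * ln (4 * n%:R) <= e * n%:R :> R.
Proof.
move=> b1 /eqO_exP[C C0 hC] e e0.
pose g := (1 - b) / 2; have g0 : 0 < g by rewrite divr_gt0 // subr_gt0.
pose C' := C * (4 `^ g / g).
have C'0 : 0 < C' by rewrite mulr_gt0 // divr_gt0 // powR_gt0.
near=> n.
have n1 : 1 <= n%:R :> R by near: n; exact: nbhs_infty_ger.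
have n0 : 0 < n%:R :> R by apply: lt_le_trans n1.
have hn : (C' / e) `^ g^-1 <= n%:R by near: n; exact: nbhs_infty_ger.
have hp : (p n)%:R <= C * n%:R `^ b.
  have : `|(p n)%:R : R| <= C * `|n%:R `^ b : R| by near: n.
  by rewrite !ger0_norm ?powR_ge0.
have hln : ln (4 * n%:R) <= 4 `^ g / g * n%:R `^ g.
  have x0 : 0 < 4 * n%:R :> R by rewrite mulr_gt0.
  have := ln_sublinear (powR_gt0 g x0); rewrite ln_powR powRM // => /ltW h.
  by rewrite mulrAC ler_pdivlMr // mulrC.
have ne : C' / e <= n%:R `^ g.
  have -> : C' / e = ((C' / e) `^ g^-1) `^ g.
    by rewrite -powRrM mulVf ?gt_eqF // powRr1 // divr_ge0 // ltW.
  by apply: (ge0_ler_powR (ltW g0)); rewrite ?nnegrE ?powR_ge0.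
have nE : n%:R = n%:R `^ b * n%:R `^ g * n%:R `^ g :> R.
  rewrite -!powRD ?(gt_eqF n0) ?implybT //.
  by rewrite -[LHS](powRr1 (ltW n0)); congr (_ `^ _); rewrite /g; field.
apply: (@le_trans _ _ (C * n%:R `^ b * (4 `^ g / g * n%:R `^ g))).
  by apply: ler_pM => //; rewrite ln_ge0 //; lra.
have -> : C * n%:R `^ b * (4 `^ g / g * n%:R `^ g) =
  C' * (n%:R `^ b * n%:R `^ g) by rewrite /C'; ring.
rewrite [in leRHS]nE; set w := n%:R `^ b * _.
have -> : e * (w * n%:R `^ g) = e * n%:R `^ g * w by ring.
by rewrite ler_wpM2r ?mulr_ge0 ?powR_ge0 // -ler_pdivrMl // mulrC.
Unshelve. all: by end_near.
Qed.

(** The logarithm [ln (4 n)] is at least 1 as soon as [n >= exp 1]. *)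
Lemma little_of_mul_ln (p : nat -> nat) :
  (forall e : R, 0 < e ->
     \forall n \near \oo, (p n)%:R * ln (4 * n%:R) <= e * n%:R :> R) ->
  forall e : R, 0 < e -> \forall n \near \oo, (p n)%:R <= e * n%:R :> R.
Proof.
move=> h e e0; near=> n.
have hn : expR 1 <= n%:R :> R by near: n; exact: nbhs_infty_ger.
have n0 : 0 < n%:R :> R by apply: lt_le_trans hn; exact: expR_gt0.
apply: (@le_trans _ _ ((p n)%:R * ln (4 * n%:R))); last by near: n; exact: h.
rewrite ler_peMr // -[leLHS](expRK 1) ler_ln ?posrE ?expR_gt0 ?mulr_gt0 //.
by apply: (le_trans hn); rewrite ler_peMl ?ler1n // ltW.
Unshelve. all: by end_near.
Qed.

End Asymptotics.

(** * Consistency under both models *)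

Theorem corollary4 (R : realType) (n0 : nat) (i p : nat -> nat) (a b : R)
    (X : forall n : nat, 'M[R]_(n, p n))
    (c : forall n : nat, 'I_(i n) -> 'I_(p n))
    (hip : forall n : nat, (n0 <= n)%N ->
       [/\ (1 <= i n)%N, (i n < p n)%N & (p n < n)%N])
    (hX : forall n : nat, (n0 <= n)%N -> \rank (X n) = p n)
    (hc : forall n : nat, (n0 <= n)%N -> injective (c n))
    (ha : 0 <= a) (hab : a <= b) (hb : b < 1)
    (hi : (fun n : nat => (i n)%:R : R) =O_\oo (fun n : nat => n%:R `^ a : R))
    (hp : (fun n : nat => (p n)%:R : R) =O_\oo (fun n : nat => n%:R `^ b : R)) :
  (forall (d : nat -> measure_display) (T : forall n, measurableType (d n))
      (P : forall n, probability (T n) R) (y : forall n, T n -> 'cV[R]_n)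
      (alpha : forall n, 'cV[R]_(i n)) (sigma : nat -> R),
    (forall n, (n0 <= n)%N -> 0 < sigma n) ->
    (forall n, (n0 <= n)%N ->
       normal_vector (P n) (y n) (colsub (c n) (X n) *m alpha n)
         ((sigma n ^+ 2)%:M)) ->
    cvg_prob0 P (fun n w => bayes_factor (colsub (c n) (X n)) (X n) (y n w)))
  /\
  (forall (d : nat -> measure_display) (T : forall n, measurableType (d n))
      (P : forall n, probability (T n) R) (y : forall n, T n -> 'cV[R]_n)
      (beta : forall n, 'cV[R]_(p n)) (sigma : nat -> R) (delta : R),
    (forall n, (n0 <= n)%N -> 0 < sigma n) ->
    (forall n, (n0 <= n)%N ->
       normal_vector (P n) (y n) (X n *m beta n) ((sigma n ^+ 2)%:M)) ->
    model_distance (colsub (c n) (X n)) (X n) (beta n) (sigma n)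
      @[n --> \oo] --> delta ->
    0 < delta ->
    cvg_prob_pinfty P
      (fun n w => bayes_factor (colsub (c n) (X n)) (X n) (y n w))).
Proof.
have pln := mul_ln_little hb hp.
have plin := little_of_mul_ln pln.
split.
  move=> d T P y alpha sigma sigma0 hy eps eps0.
  apply: cvge_near_le => e e0.
  (* Each of the two error terms [4 r] and [6 / M] equals [e / 2]. *)
  pose r := e / 8; pose M := 12 / e; pose L := M / r ^+ 2.
  have r0 : 0 < r by rewrite divr_gt0.
  have M0 : 0 < M by rewrite divr_gt0.
  have L0 : 0 < L by rewrite divr_gt0 // exprn_gt0.
  pose m := Num.min 1 (eps ^+ 2).
  have m0 : 0 < m by rewrite lt_min ltr01 exprn_gt0.
  (* Two thresholds for [p / n]: the first gives [2 L (p - i) <= n - p], the second gives [q <= m]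
     through [p + 1 <= 2 p]. *)
  have h1 : 0 < (2 * L + 1)^-1 by rewrite invr_gt0 addr_gt0 // mulr_gt0.
  have h2 : 0 < m / (4 * expR (2 * L)) by rewrite divr_gt0 // mulr_gt0 // expR_gt0.
  near=> n.
  have nn0 : (n0 <= n)%N by near: n; exact: nbhs_infty_ge.
  have [i1 ip pn] := hip n nn0.
  have N0 : 0 < n%:R :> R by rewrite ltr0n (leq_ltn_trans _ pn).
  have hp1 : (p n)%:R <= (2 * L + 1)^-1 * n%:R by near: n; exact: plin.
  have hp2 : (p n)%:R <= m / (4 * expR (2 * L)) * n%:R by near: n; exact: plin.
  rewrite sub0r add0r; apply/andP; split.
    by apply: (@le_trans _ _ 0%E); rewrite ?lee_fin ?oppr_le0 ?measure_ge0 // ltW.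
  have hq : 2 * (p n).+1%:R / n%:R * expR (2 * L) <= m.
    rewrite mulrAC ler_pdivrMr //.
    apply: (@le_trans _ _ (4 * expR (2 * L) * (p n)%:R)).
      have : (p n).+1%:R <= 2 * (p n)%:R :> R.
        by rewrite -natrM ler_nat mul2n -addnn -addn1 leq_add2l (leq_trans i1) // ltnW.
      rewrite -(ler_pM2r (expR_gt0 (2 * L))); lra.
    by rewrite -ler_pdivlMl ?mulr_gt0 ?expR_gt0 // mulrA (mulrC _^-1).
  have := @bayes_factor_null_tail R n (i n) (p n) (X n) (c n) _ _ (P n) (y n)
    (sigma n) ip pn (hX n nn0) (hc n nn0) (sigma0 n nn0) (alpha n) r M eps
    (hy n nn0) r0 M0 eps0.
  have -> : 4 * r + 6 / M = e by rewrite /r /M; field; rewrite gt_eqF.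
  apply.
  - have : 0 <= (i n)%:R :> R by [].
    have L1 : 0 < 2 * L + 1 by lra.
    move: hp1; rewrite ler_pdivlMl // => hp1 i0.
    have := mulr_ge0 i0 (ltW L0); rewrite -/L; lra.
  - by apply: (le_trans hq); rewrite /m ge_min lexx.
  - by apply: (le_trans hq); rewrite /m ge_min lexx orbT.
move=> d T P y beta sigma delta sigma0 hy hdelta delta0 K.
apply: cvge_near_le => e e0.
(* Half the limit is a lower bound on the distance for all large [n]; [6 / M] is again [e / 2]. *)
pose M := 12 / e; pose dl := delta / 2.
pose eta := (dl / 2) / (M + dl / 2).
have M0 : 0 < M by rewrite divr_gt0.
have dl0 : 0 < dl by rewrite divr_gt0.
have eta0 : 0 < eta by rewrite divr_gt0 // ?addr_gt0 // divr_gt0.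
have h1 : 0 < eta / 16 by rewrite divr_gt0.
near=> n.
have nn0 : (n0 <= n)%N by near: n; exact: nbhs_infty_ge.
have [i1 ip pn] := hip n nn0.
have N0 : 0 < n%:R :> R by rewrite ltr0n (leq_ltn_trans _ pn).
(* The first bound makes [96 / (n dl) <= e / 2]; the second makes [eta n / 32 >= 2 |K|], so that
   [(1 + eta n / 32) / 2] exceeds [K]. *)
have hn1 : 192 / (e * dl) <= n%:R by near: n; exact: nbhs_infty_ger.
have hn2 : 64 * `|K| / eta <= n%:R by near: n; exact: nbhs_infty_ger.
have hn3 : 1 <= n%:R :> R by near: n; exact: nbhs_infty_ger.
have hp1 : (p n)%:R <= 2^-1 * n%:R :> R by near: n; apply: plin; rewrite invr_gt0.
have hp2 : (p n)%:R * ln (4 * n%:R) <= eta / 16 * n%:R by near: n; exact: pln.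
have hd : dl <= model_distance (colsub (c n) (X n)) (X n) (beta n) (sigma n).
  by near: n; apply: (cvgr_ge _ hdelta); rewrite /dl; lra.
have mA := measurable_bayes_factor_gt ip pn (hX n nn0) (hc n nn0) (hy n nn0) K%:E.
have hK : K < 2^-1 * (expR (eta / 4 * ((n%:R - (p n)%:R) / 2)) /
    (4 * n%:R) `^ (((p n)%:R - (i n)%:R) / 2)).
  rewrite /powR gt_eqF ?mulr_gt0 // -expRN -expRD.
  have l0 : 0 <= ln (4 * n%:R : R) by rewrite ln_ge0 //; lra.
  have i0 : 0 <= (i n)%:R * ln (4 * n%:R) :> R by rewrite mulr_ge0.
  have hp3 : eta * (p n)%:R <= eta * (2^-1 * n%:R) by rewrite ler_pM2l.
  (* As [p <= n / 2], the gain is at least [eta n / 16], and the logarithmic loss is at most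
     [eta n / 32]. *)
  have hexp : eta / 32 * n%:R <= eta / 4 * ((n%:R - (p n)%:R) / 2) +
      - (((p n)%:R - (i n)%:R) / 2 * ln (4 * n%:R)) by lra.
  have := expR_ge1Dx (eta / 32 * n%:R); rewrite -ler_expR in hexp.
  have hK2 : 64 * `|K| <= eta * n%:R by rewrite [leRHS]mulrC -ler_pdivrMr.
  have := ler_norm K; lra.
have := @bayes_factor_alternative_tail R n (i n) (p n) (X n) (c n) _ _ (P n)
  (y n) (sigma n) ip pn (hX n nn0) (hc n nn0) (sigma0 n nn0) (beta n) dl M K
  (hy n nn0) dl0 M0 hd hK.
rewrite probability_setC //.
set A := [set w | _] in mA *.
have fA : P n A \is a fin_num by exact: fin_num_measure.
have PA1 : (P n A <= 1)%E by exact: probability_le1.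
move: PA1; rewrite -(fineK fA) !lee_fin => PA1 hA.
have : 6 / M + 96 / (n%:R * dl) <= e.
  have -> : 6 / M = e / 2 by rewrite /M; field; rewrite gt_eqF.
  have : 96 / (n%:R * dl) <= e / 2; last by lra.
  move: hn1; rewrite ler_pdivrMr ?mulr_gt0 // ler_pdivrMr ?mulr_gt0 //; lra.
have : 1 - fine (P n A) <= 6 / M + 96 / (n%:R * dl) by rewrite -lee_fin EFinB.
by move=> ? ?; apply/andP; split; lra.
Unshelve. all: by end_near.
Qed.
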